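(* Let $T$ be the generalized triangle, i.e. the $3$-graph with vertex set $\{v_1,v_2,v_3,v_4,v_5\}$ and edge set $\{\{v_1,v_2,v_3\},\{v_1,v_2,v_4\},\{v_3,v_4,v_5\}\}$. For $n\ge 5$, $$c_2(n,T)=\begin{cases}1, & n\in[5,10],\\ 2, & n\ge 11 \text{ and } n-1\equiv 0 \pmod 3,\\ 1, & n\ge 11 \text{ and } n-1\equiv 1 \text{ or } 2 \pmod 3.\end{cases}$$
   Context: A $3$-graph $G=(V,E)$ has $E$ a family of $3$-element subsets of $V$. For $S\subseteq V$, $d_G(S)$ is the number of edges containing $S$; for $i\in\{1,2\}$ the minimum $i$-degree $\delta_i(G)$ is the minimum of $d_G(S)$ over all $i$-subsets $S$ of $V$. For a $3$-graph $F$, $G$ has an $F$-covering if every vertex of $G$ lies in some copy of $F$ in $G$ (a subgraph isomorphic to $F$). $c_i(n,F)$ is the maximum of $\delta_i(G)$ over all $n$-vertex $3$-graphs $G$ that have no $F$-covering. *)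

(* Defs.v *)
From HB Require Import structures.
From mathcomp Require Import all_boot.

Set Implicit Arguments.
Unset Strict Implicit.
Unset Printing Implicit Defensive.

Record graph3 (V : finType) := Graph3 {
  edges :> {set {set V}};
  edges_card : [forall e in edges, #|e| == 3] }.

HB.instance Definition _ (V : finType) := [isSub for @edges V].
HB.instance Definition _ (V : finType) := [Equality of graph3 V by <:].
HB.instance Definition _ (V : finType) := [Choice of graph3 V by <:].
HB.instance Definition _ (V : finType) := [Countable of graph3 V by <:].
HB.instance Definition _ (V : finType) := [Finite of graph3 V by <:].

Definition degree (V : finType) (G : graph3 V) (S : {set V}) : nat :=
  #|[set e in G | S \subset e]|.

(* The neutral element #|G| bounds every degree from above, so it does not
   affect the minimum as soon as V has an i-subset, i.e. i <= #|V|. *)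
Definition min_degree (i : nat) (V : finType) (G : graph3 V) : nat :=
  \big[minn/#|G|]_(S : {set V} | #|S| == i) degree G S.

Definition subgraph (V : finType) (G : graph3 V) (U : {set V}) (D : graph3 V)
    : bool :=
  (D \subset G) && [forall e in D, e \subset U].

Definition isomorphic_to (W V : finType) (F : graph3 W)
    (U : {set V}) (D : graph3 V) : bool :=
  [exists f : {ffun W -> V},
    [&& injectiveb f, f @: [set: W] == U
      & [set f @: (e : {set W}) | e in F] == D]].

Definition has_covering (W V : finType) (F : graph3 W) (G : graph3 V) : bool :=
  [forall v : V, exists U : {set V}, exists D : graph3 V,
    [&& subgraph G U D, isomorphic_to F U D & v \in U]].

(* Degrees and coverings are isomorphism invariant, so n-vertex 3-graphs are
   taken on 'I_n.  If F has an edge and n > 0, the edgeless 3-graph has no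
   F-covering, so this is a maximum over a nonempty family. *)
Definition covering_threshold (i n : nat) (W : finType) (F : graph3 W) : nat :=
  \max_(G : graph3 'I_n | ~~ has_covering F G) min_degree i G.

Definition triangle_edges : {set {set 'I_5}} :=
  let v1 : 'I_5 := @Ordinal 5 0 isT in
  let v2 : 'I_5 := @Ordinal 5 1 isT in
  let v3 : 'I_5 := @Ordinal 5 2 isT in
  let v4 : 'I_5 := @Ordinal 5 3 isT in
  let v5 : 'I_5 := @Ordinal 5 4 isT in
  [set [set v1; v2; v3]; [set v1; v2; v4]; [set v3; v4; v5]].

Lemma triangle_edges_card : [forall e in triangle_edges, #|e| == 3].
Proof.
apply/forall_inP => e; rewrite !inE -orbA.
by case/or3P => /eqP->; rewrite -setUA !cardsU1 cards1 !inE.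
Qed.

Definition generalized_triangle : graph3 'I_5 := Graph3 triangle_edges_card.

(* Main.v *)
(** Let x be a vertex of a 3-graph G that lies in no copy of T, and suppose that
    delta_2(G) >= 2.  If b, c are neighbours of a in the link graph of x and
    bce is an edge, then e is x or a, for otherwise xab, xac, bce form a copy of
    T.  Hence the pair bc has degree exactly 2, both xbc and abc are edges, and
    the link of x is a disjoint union of triangles; so n = 1 mod 3 and
    delta_2(G) = 2.  A pair ad of vertices in distinct triangles has two
    neighbours e, f, which lie outside these two triangles, and in distinct
    triangles: otherwise ade, adf, efx form a copy of T.  So there are at least
    four triangles and n >= 13.

    Conversely, all triples through one vertex give delta_2 = 1 for every n.
    For n = 3k + 1 with k >= 4, split all vertices but x into k groups of size 3
    labelled by Z/3, and take the groups, the pairs of a group together with x,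
    and the transversal triples with label sum 0.  *)
Require Import Defs.
From mathcomp Require Import all_boot.
From mathcomp Require Import zify.

Set Implicit Arguments.
Unset Strict Implicit.
Unset Printing Implicit Defensive.

(** * Codegrees, and copies of T as tuples of vertices *)

Section Graph3.

Variables (V : finType) (G : graph3 V).
Implicit Types (a b c d e v : V) (S : {set V}).

Lemma setU3_CA a b c : [set a; b; c] = [set b; a; c].
Proof. by rewrite [[set a; b]]setUC. Qed.

Lemma setU3_AC a b c : [set a; b; c] = [set a; c; b].
Proof. by rewrite setUAC. Qed.

Lemma cards3 a b c : (#|[set a; b; c]| == 3) = uniq [:: a; b; c].
Proof.
by rewrite -setUA !cardsU1 cards1 !inE /= !inE; case: (a == b); case: (a == c); case: (b == c).
Qed.

Lemma edge_uniq a b c : [set a; b; c] \in edges G -> uniq [:: a; b; c].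
Proof. by move/(forall_inP (edges_card G)); rewrite cards3. Qed.

Definition codegree a b := #|[set c | [set a; b; c] \in edges G]|.

(** Edges on the pair correspond to their third vertices; the correspondence is injective because
    the three vertices of an edge are distinct. *)
Lemma degree2E a b : a != b -> degree G [set a; b] = codegree a b.
Proof.
move=> neq_ab; rewrite /degree /codegree.
rewrite -(card_in_imset (f := fun c => [set a; b; c])); last first.
  move=> c d; rewrite !inE => /edge_uniq uc _ /setP/(_ c).
  move: uc; rewrite /= !inE eqxx orbT !negb_or andbT => /andP[/andP[_ ac] bc].
  by rewrite ![c == _]eq_sym (negPf ac) (negPf bc) /= eq_sym => /esym/eqP.
congr #|pred_of_set _|; apply/setP=> e; apply/setIdP/imsetP=> [[Ge sub]|[c]].
  have /eqP ce := forall_inP (edges_card G) e Ge.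
  have /cards1P[c ec] : #|e :\: [set a; b]| == 1.
    by rewrite cardsD (setIidPr sub) ce cards2 neq_ab.
  have ee : e = [set a; b; c] by rewrite -ec -[LHS](setID e [set a; b]) (setIidPr sub).
  by exists c; rewrite // inE -ee.
by rewrite inE => Gc ->; split=> //; rewrite subsetUl.
Qed.

Lemma min_degree_le i S : #|S| = i -> min_degree i G <= degree G S.
Proof. move=> /eqP cS; rewrite /min_degree; move: (mem_index_enum S).
elim: (index_enum _) => // T r IHr; rewrite inE big_cons.
case/predU1P=> [<-|/IHr le]; first by rewrite cS geq_minl.
by case: ifP => // _; rewrite (leq_trans (geq_minr _ _)).
Qed.

Lemma min_degree2_le a b : a != b -> min_degree 2 G <= codegree a b.
Proof. by move=> ab; rewrite -degree2E // min_degree_le // cards2 ab. Qed.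

Lemma min_degree2_ge m : 1 < #|V| ->
  (forall a b, a != b -> m <= codegree a b) -> m <= min_degree 2 G.
Proof.
move=> V2 hm; have degm S (S2 : #|S| == 2) : m <= degree G S.
  by case/cards2P: S2 => a [b [ab ->]]; rewrite degree2E ?hm.
apply: (big_ind (fun k => m <= k)) => [|p q mp mq|//]; last by rewrite leq_min mp.
(* The neutral element [#|G|] must be at least [m] too: it bounds the degree of any pair, and
   [1 < #|V|] provides one. *)
have /card_gt1P[a [b [_ _ ab]]] : 1 < #|[set: V]| by rewrite cardsT.
apply: (leq_trans (degm [set a; b] _)); first by rewrite cards2 ab.
by apply: subset_leq_card; apply/subsetP=> e /setIdP[].
Qed.

Lemma codegree_gt0 a b c : [set a; b; c] \in edges G -> 0 < codegree a b.
Proof. by move=> Gc; apply/card_gt0P; exists c; rewrite inE. Qed.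

Lemma codegree_gt1 a b c d : c != d ->
  [set a; b; c] \in edges G -> [set a; b; d] \in edges G -> 1 < codegree a b.
Proof. by move=> cd Gc Gd; apply/card_gt1P; exists c, d; rewrite !inE. Qed.

Definition triangle_copy a b c d e :=
  [&& uniq [:: a; b; c; d; e], [set a; b; c] \in edges G,
      [set a; b; d] \in edges G & [set c; d; e] \in edges G].

Definition triangle_covered v :=
  exists a b c d e, triangle_copy a b c d e /\ v \in [:: a; b; c; d; e].

Lemma not_has_covering_triangleP :
  reflect (exists v, ~ triangle_covered v)
    (~~ has_covering generalized_triangle G).
Proof.
pose o i (lti : i < 5) := Ordinal lti.
pose s := [:: o 0 isT; o 1 isT; o 2 isT; o 3 isT; o 4 isT].
have imset3 (f : 'I_5 -> V) i j k : f @: [set i; j; k] = [set f i; f j; f k].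
  by rewrite !imsetU !imset_set1.
rewrite negb_forall.
apply: (iffP existsP) => -[v cov]; exists v; last first.
  apply: contra_notN cov => /existsP[U /existsP[D /and3P[/andP[DG _] iso Uv]]].
  case/existsP: iso => f /and3P[/injectiveP injf /eqP fU /eqP fD].
  exists (f (o 0 isT)), (f (o 1 isT)), (f (o 2 isT)), (f (o 3 isT)), (f (o 4 isT)).
  have Gf (t : {set 'I_5}) : t \in triangle_edges -> f @: t \in edges G.
    by move=> tT; apply: (subsetP DG); rewrite -fD; apply/imsetP; exists t.
  split; last first.
    move: Uv; rewrite -fU => /imsetP[i _ ->].
    apply: (map_f f (s := s)).
    by case: i => [[|[|[|[|[|]]]]]].
  apply/and4P; split; rewrite -?imset3 ?Gf ?inE ?eqxx ?orbT //.
  by rewrite (map_inj_uniq injf s).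
case=> [a [b [c [d [e [/and4P[us Gabc Gabd Gcde] vin]]]]]].
move/negP: cov; case.
pose t := [:: a; b; c; d; e]; pose f := [ffun i : 'I_5 => nth a t i].
have injf : injective f.
  by move=> i j; rewrite !ffunE => /eqP; rewrite nth_uniq // => /eqP/val_inj.
pose E := [set f @: (e : {set 'I_5}) | e in generalized_triangle].
have EG : E \subset edges G.
  apply/subsetP=> ? /imsetP[t' + ->]; rewrite !inE -orbA.
  by case/or3P=> /eqP->; rewrite imset3 !ffunE.
have cE : [forall e in E, #|e| == 3].
  by apply/forall_inP=> h /(subsetP EG)/(forall_inP (edges_card G)).
apply/existsP; exists (f @: [set: 'I_5]); apply/existsP; exists (Graph3 cE).
apply/and3P; split.
- rewrite /subgraph EG; apply/forall_inP=> ? /imsetP[t' _ ->].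
  by rewrite imsetS ?subsetT.
- by apply/existsP; exists f; rewrite !eqxx !andbT; apply/injectiveP.
- apply/imsetP; exists (inord (index v t)) => //.
  by rewrite ffunE inordK ?nth_index // -[5]/(size t) index_mem.
Qed.

End Graph3.

(** * The link of an uncovered vertex *)

Section Uncovered.

Variables (V : finType) (G : graph3 V) (x : V).
Hypothesis x_uncovered : ~ triangle_covered G x.
Hypothesis codegree_ge2 : forall a b, a != b -> 1 < codegree G a b.
Implicit Types a b c d e : V.

Let E a b c := [set a; b; c] \in edges G.
Let L := E x.

Let E_CA a b c : E a b c = E b a c. Proof. by rewrite /E setU3_CA. Qed.
Let E_AC a b c : E a b c = E a c b. Proof. by rewrite /E setU3_AC. Qed.

Lemma link_sym a b : L a b = L b a. Proof. exact: E_AC. Qed.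

Lemma link_neq a b : L a b -> [&& a != x, b != x & a != b].
Proof.
move/edge_uniq; rewrite /= !inE negb_or andbT => /andP[/andP[xa xb] ->].
by rewrite ![_ == x]eq_sym xa xb.
Qed.

Lemma link_cherry a b c e : L a b -> L a c -> b != c -> E b c e -> e = x \/ e = a.
Proof.
move=> Lab Lac bc Ebce; have [->|ex] := eqVneq e x; first by left.
have [->|ea] := eqVneq e a; first by right.
case: x_uncovered; exists x, a, b, c, e; split; last by rewrite inE eqxx.
have /and3P[ax bx ab] := link_neq Lab; have /and3P[_ cx ac] := link_neq Lac.
rewrite /triangle_copy [_ \in _]Lab [_ \in _]Lac [_ \in _]Ebce !andbT /=.
move: (edge_uniq Ebce); rewrite /= !inE !negb_or bc ab ac /=.
rewrite !andbT => /andP[be ce]; rewrite ![x == _]eq_sym ax bx cx ex.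
by rewrite [a == e]eq_sym ea be ce.
Qed.

Lemma link_cherry_closed a b c :
  L a b -> L a c -> b != c -> L b c /\ E b c a.
Proof.
move=> Lab Lac bc; have sub : [set e | E b c e] \subset [set x; a].
  by apply/subsetP=> e; rewrite !inE => /(link_cherry Lab Lac bc)[]->; rewrite eqxx ?orbT.
have /eqP eqN : [set e | E b c e] == [set x; a].
  rewrite eqEcard sub (leq_trans _ (codegree_ge2 bc)) // cards2.
  by case: eqP.
move/setP: eqN => eqN; split; last by move: (eqN a); rewrite !inE eqxx orbT.
by rewrite /L E_CA E_AC; move: (eqN x); rewrite !inE eqxx.
Qed.

(** Two neighbours come from the codegree of [x] and [a]. With a third one, b, c, d would be
    pairwise adjacent in the link. The cherry at d then makes bcd an edge, while the cherry at [a]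
    allows only [x] and [a] as third vertices on bc. *)
Lemma card_link a : a != x -> #|[set b | L a b]| = 2.
Proof.
rewrite eq_sym => xa; apply/eqP; rewrite eqn_leq codegree_ge2 // andbT leqNgt.
apply/negP=> /card_gt2P[b [c [d [[]]]]]; rewrite !inE => Lb Lc Ld [bc cd db].
have [Lbd _] := link_cherry_closed Ld Lb db.
have [Lcd _] := link_cherry_closed Lc Ld cd.
have [_ Ebcd] := link_cherry_closed Lbd (etrans (link_sym _ _) Lcd) bc.
have /and3P[_ dx da] := link_neq Ld.
by case: (link_cherry Lb Lc bc Ebcd) => e; rewrite e eqxx in dx da.
Qed.

(** Let d be the second link neighbour of [a]. The cherry at d with ends [a] and [b] leaves only [x]
    and d as third vertices on [ab], so [c] is d. *)
Lemma link_edge_closed a b c : L a b -> E a b c -> c != x -> L a c.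
Proof.
move=> Lab Eabc cx; have /and3P[ax bx ab] := link_neq Lab.
have : 0 < #|[set d | L a d] :\ b|.
  by move: (cardsD1 b [set d | L a d]); rewrite card_link // inE Lab; case: #|_|.
case/card_gt0P=> d; rewrite !inE => /andP[db Lad].
have [Ldb _] := link_cherry_closed Lad Lab db.
case: (link_cherry (etrans (link_sym _ _) Lad) Ldb ab Eabc) => cE.
  by rewrite cE eqxx in cx.
by rewrite cE.
Qed.

Let same a b := (a == b) || L a b.

Lemma same_equivalence : {in [set~ x] & &, equivalence_rel same}.
Proof.
move=> a b c _ _ _; rewrite /same eqxx; split=> //.
case/predU1P=> [-> //|Lab].
have /and3P[_ _ ab] := link_neq Lab.
apply/predU1P/predU1P=> -[|] => [<-|Lac|<-|Lbc].
- by right; rewrite link_sym.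
- have [->|bc] := eqVneq b c; first by left.
  by right; case: (link_cherry_closed Lab Lac bc).
- by right.
- have [->|ac] := eqVneq a c; first by left.
  by right; case: (link_cherry_closed (etrans (link_sym _ _) Lab) Lbc ac).
Qed.

Let P := equivalence_partition same [set~ x].

Lemma link_partition : partition P [set~ x].
Proof. exact: equivalence_partitionP same_equivalence. Qed.

(** Each part is a vertex with its two link neighbours, and the parts miss only [x]. *)
Lemma card_uncovered : #|V| = #|P| * 3 + 1.
Proof.
rewrite -(card_uniform_partition (n := 3) _ link_partition) ?addn1.
  by rewrite cardsC1 prednK //; apply/card_gt0P; exists x.
move=> _ /imsetP[a + ->]; rewrite !inE => ax.
have -> : [set b in [set~ x] | same a b] = a |: [set b | L a b].
  apply/setP=> b; rewrite !inE [b == a]eq_sym /same.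
  have [<-|_] := eqVneq a b; first by rewrite ax.
  by apply: andb_idl => /link_neq/and3P[].
rewrite cardsU1 card_link // inE.
by case Laa: (L a a) => //; move/link_neq: Laa; rewrite eqxx !andbF.
Qed.

Lemma uncovered_parts : 5 <= #|V| -> 3 < #|P|.
Proof.
move=> V5.
have /card_gt0P[a] : 0 < #|[set~ x]| by rewrite cardsC1; lia.
rewrite !inE => ax.
(* The vertex [x] and the part of [a] make up at most four vertices, so a fifth one lies in another
   part. *)
have /card_gt0P[d] : 0 < #|~: (x |: (a |: [set b | L a b]))|.
  rewrite -subn_gt0 cardsCs setCK subn0 subn_gt0.
  by rewrite !cardsU1 card_link // (leq_ltn_trans _ V5) //; do 2!case: (_ \notin _).
rewrite !inE !negb_or => /and3P[dx da nLad].
have ad : a != d by rewrite eq_sym.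
have /card_gt1P[e [f [+ + ef]]] := codegree_ge2 ad; rewrite !inE.
rewrite -/(E _ _ _) -/(E a d f) => Ee Ef.
(* If [c] were [x], or in the part of [a] or [d], then [a] and [d] would be adjacent in the link, in
   the last two cases by [link_edge_closed]. *)
have far c : E a d c -> [&& c != x, ~~ same a c & ~~ same d c].
  move=> Ec; have /= := edge_uniq Ec; rewrite !inE !negb_or !andbT => /andP[/andP[_ ac] dc].
  rewrite /same (negPf ac) (negPf dc) /=; apply/and3P; split.
  - by apply: contraNneq nLad => cx; rewrite /L E_CA E_AC -cx.
  - by apply: contra nLad => Lac; apply: (link_edge_closed Lac) dx; rewrite E_AC.
  - apply: contra nLad => Ldc; rewrite link_sym.
    by apply: (link_edge_closed Ldc) ax; rewrite E_AC E_CA.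
have /and3P[ex ae de] := far e Ee; have /and3P[fx af df] := far f Ef.
have nef : ~~ same e f.
  rewrite /same (negPf ef) /=; apply: contra_notN x_uncovered => Lef.
  exists a, d, e, f, x; split; last by rewrite !inE eqxx !orbT.
  rewrite /triangle_copy [_ \in _]Ee [_ \in _]Ef /=.
  have -> : [set e; f; x] \in edges G by rewrite -[_ \in _]/(E e f x) E_AC E_CA.
  move: (edge_uniq Ee) (edge_uniq Ef); rewrite /= !inE !negb_or !andbT.
  by move=> /andP[/andP[-> ->] ->] /andP[/andP[_ ->] ->]; rewrite ef ax dx ex fx.
have nad : ~~ same a d by rewrite /same (negPf ad).
have /and3P[/eqP covP trivP _] := link_partition.
have blockN b c : b != x -> c != x -> ~~ same b c -> pblock P b != pblock P c.
  move=> bx cx; rewrite eq_pblock ?covP ?inE //.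
  by rewrite (pblock_equivalence_partition same_equivalence) ?inE.
have sP : {subset map (pblock P) [:: a; d; e; f] <= enum P}.
  move=> B /mapP[b bin ->]; rewrite mem_enum pblock_mem // covP inE in_set1.
  by move: bin; rewrite !inE => /or4P[]/eqP->.
rewrite cardE; apply: leq_trans (uniq_leq_size _ sP) => //.
by rewrite /= !inE !negb_or !blockN.
Qed.

(** Such a pair caps the minimum 2-degree at 2. *)
Lemma uncovered_codegree2 : 1 < #|V| -> exists a b, a != b /\ codegree G a b = 2.
Proof.
move=> V1; have /card_gt0P[a] : 0 < #|[set~ x]| by rewrite cardsC1; lia.
by rewrite !inE => ax; exists x, a; rewrite eq_sym ax -(card_link ax).
Qed.

End Uncovered.

(** * Bounds on the threshold, and the star construction *)

Lemma threshold_le m n :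
  (forall (G : graph3 'I_n) x, ~ triangle_covered G x -> min_degree 2 G <= m) ->
  covering_threshold 2 n generalized_triangle <= m.
Proof. by move=> le_m; apply/bigmax_leqP => G /not_has_covering_triangleP[x /le_m]. Qed.

Lemma threshold_ge n (G : graph3 'I_n) x :
  ~ triangle_covered G x ->
  min_degree 2 G <= covering_threshold 2 n generalized_triangle.
Proof.
by move=> Gx; apply: leq_bigmax_cond; apply/not_has_covering_triangleP; exists x.
Qed.

Definition star_edges (V : finType) (x : V) :=
  [set e : {set V} | (#|e| == 3) && (x \in e)].

Lemma star_edges_card (V : finType) (x : V) :
  [forall e in star_edges x, #|e| == 3].
Proof. by apply/forall_inP => e; rewrite inE => /andP[]. Qed.

Lemma star_threshold n : 2 < n -> 0 < covering_threshold 2 n generalized_triangle.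
Proof.
case: n => // n n2; pose G := Graph3 (star_edges_card (@ord0 n)).
have GE a b c : ([set a; b; c] \in edges G) =
    uniq [:: a; b; c] && (ord0 \in [:: a; b; c]).
  by rewrite inE cards3 !inE orbA.
apply: leq_trans (threshold_ge (G := G) (x := ord0) _).
  apply: min_degree2_ge => [|a b ab]; first by rewrite card_ord ltnW.
  have [x0|x0] := boolP (ord0 \in [:: a; b]).
    have /card_gt0P[c] : 0 < #|~: [set a; b]|.
      by rewrite cardsCs setCK card_ord cards2 ab subn_gt0.
    rewrite !inE negb_or => /andP[ca cb]; apply: (@codegree_gt0 _ _ _ _ c).
    rewrite GE /= !inE negb_or ab ![_ == c]eq_sym ca cb /=.
    by move: x0; rewrite !inE => /orP[]->; rewrite ?orbT.
  apply: (@codegree_gt0 _ _ _ _ ord0); move: x0; rewrite GE /= !inE !negb_or ab.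
  by rewrite ![ord0 == _]eq_sym => /andP[-> ->]; rewrite eqxx !orbT.
(* All edges of the star contain [ord0], whereas the three edges of T have no common vertex. *)
case=> a [b [c [d [e [/and4P[us + + +] _]]]]]; rewrite !GE.
move=> /andP[_ xabc] /andP[_ xabd] /andP[_ xcde].
have excl u v : u != v -> (ord0 == u) && (ord0 == v) = false.
  by move=> uv; apply: contraNF uv => /andP[/eqP<- /eqP<-].
move: us xabc xabd xcde; rewrite /= !inE !negb_or.
case/and5P=> /and4P[_ /excl ac /excl ad /excl ae] /and3P[/excl bc /excl bd /excl be].
move=> /andP[/excl cd _] _ _; move: ac ad ae bc bd be cd.
by do 5!case: (ord0 == _).
Qed.

(** * The construction with 2-degree two on [(3 * k).+1] vertices *)

(* The groups are {3i, 3i+1, 3i+2} for i < k, and x is the vertex 3k. *)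
Definition compat k a b := [|| a == 3 * k, b == 3 * k | a %/ 3 == b %/ 3].

(** The label of a vertex is its residue mod 3, so label sum 0 means that 3 divides [a + b + c].
    Working on natural numbers makes [lia] applicable. *)
Definition triple_edge k a b c :=
  [&& compat k a b, compat k a c & compat k b c] ||
  [&& ~~ compat k a b, ~~ compat k a c, ~~ compat k b c & 3 %| a + b + c].

(** Quantifying over the set [e] avoids choosing an order of its vertices; [mem_triple_edges]
    recovers [triple_edge]. *)
Definition triple_edges k : {set {set 'I_(3 * k).+1}} :=
  [set e : {set 'I__} | (#|e| == 3) &&
    ([forall a in e, forall b in e, compat k a b] ||
     [forall a in e, forall b in e, (a != b) ==> ~~ compat k a b] &&
     (3 %| \sum_(a in e) a))].

Lemma triple_edges_card k : [forall e in triple_edges k, #|e| == 3].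
Proof. by apply/forall_inP => e; rewrite inE => /andP[]. Qed.

Lemma forall_in_set3 (T : finType) (p : pred T) a b c :
  [forall z in [set a; b; c], p z] = [&& p a, p b & p c].
Proof.
apply/forall_inP/and3P=> [h|[pa pb pc] z]; first by rewrite !h ?inE ?eqxx ?orbT.
by rewrite !inE -orbA => /or3P[]/eqP->.
Qed.

Lemma compatC k a b : compat k a b = compat k b a.
Proof. by rewrite /compat orbCA [a %/ 3 == _]eq_sym. Qed.

Lemma mem_triple_edges k (a b c : 'I_(3 * k).+1) :
  ([set a; b; c] \in triple_edges k) = uniq [:: a; b; c] && triple_edge k a b c.
Proof.
rewrite inE cards3; case: (boolP (uniq _)) => //= abc.
move: (abc); rewrite /= !inE negb_or andbT => /andP[/andP[ab ac] bc].
have -> : \sum_(z in [set a; b; c]) z = a + b + c.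
  by rewrite -setUA !big_setU1 ?big_set1 ?inE ?negb_or ?ab //= addnA.
have compatxx z : compat k z z by rewrite /compat eqxx !orbT.
rewrite !forall_in_set3 !eqxx ab ac bc ![_ == a]eq_sym [c == b]eq_sym ab ac bc /=.
rewrite /triple_edge !compatxx ![compat k _ a]compatC [compat k c b]compatC.
by do 3!case: (compat k _ _); rewrite ?andbF.
Qed.

Lemma two_other_triples k a b : 3 < k -> exists i j,
  [/\ i < k, j < k & i != j] /\ [/\ i != a, i != b, j != a & j != b].
Proof.
(* If [a] or [b] is out of range, [inord] sends it to 0, which merely excludes a further index. At
   most two of at least four indices are excluded. *)
case: k => // k k3; pose A : {set 'I_k.+1} := [set inord a; inord b].
have /card_gt1P[i [j [+ + ij]]] : 1 < #|~: A|.
  rewrite cardsCs setCK card_ord cards2; lia.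
have out (z : 'I_k.+1) c : z != inord c -> z != c :> nat.
  by apply: contraNneq => <-; rewrite inord_val.
rewrite !inE !negb_or => /andP[/out ia /out ib] /andP[/out ja /out jb].
by exists i, j; rewrite !ltn_ord.
Qed.

Lemma triple_edge_codegree k a b : 3 < k -> a <= 3 * k -> b <= 3 * k -> a != b ->
  exists p q, [/\ p <= 3 * k, q <= 3 * k & p != q] /\
    [/\ a != p, b != p, a != q & b != q] /\
    triple_edge k a b p /\ triple_edge k a b q.
Proof.
move=> k3 ak bk ab; rewrite /triple_edge /compat.
have [a3|a3] := eqVneq a (3 * k).
  (* The two other members of the group of [b]. *)
  exists (3 * (b %/ 3) + (b + 1) %% 3), (3 * (b %/ 3) + (b + 2) %% 3).
  by split; [split | split; [split | split]]; lia.
have [b3|b3] := eqVneq b (3 * k).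
  exists (3 * (a %/ 3) + (a + 1) %% 3), (3 * (a %/ 3) + (a + 2) %% 3).
  by split; [split | split; [split | split]]; lia.
have [same|diff] := eqVneq (a %/ 3) (b %/ 3).
  (* The special vertex and the third member of the group: the three labels sum to 0 + 1 + 2 = 3. *)
  exists (3 * k), (3 * (a %/ 3) + (3 - (a %% 3 + b %% 3))).
  by split; [split | split; [split | split]]; lia.
have [i [j [[ik jk ij] [ia ib ja jb]]]] := two_other_triples (a %/ 3) (b %/ 3) k3.
(* The label that completes the sum to 0 mod 3; the labels of [a] and [b] add up to at most 4, so
   subtracting from 6 never truncates. *)
pose r := (6 - (a %% 3 + b %% 3)) %% 3.
exists (3 * i + r), (3 * j + r).
by split; [split | split; [split | split]]; lia.
Qed.

Lemma triple_edge_flat k a b c : triple_edge k a b c ->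
  [|| compat k a b, compat k a c | compat k b c] ->
  [/\ compat k a b, compat k a c & compat k b c].
Proof. by rewrite /triple_edge; do 3!case: (compat _ _ _). Qed.

Lemma compat_div k a b : a != 3 * k -> b != 3 * k ->
  compat k a b = (a %/ 3 == b %/ 3).
Proof. by rewrite /compat => /negPf-> /negPf->. Qed.

Lemma uniq_div3 a b c d : uniq [:: a; b; c; d] ->
  a %/ 3 = b %/ 3 -> a %/ 3 = c %/ 3 -> a %/ 3 = d %/ 3 -> False.
Proof. by rewrite /= !inE; lia. Qed.

(** The vertex [3 * k] is compatible with every vertex, so transitivity may fail through it. *)
Lemma compat_trans k b a c : b != 3 * k ->
  compat k a b -> compat k b c -> compat k a c.
Proof.
rewrite /compat => /negPf->; case: eqP => //= _ /eqP->.
by case: (c == _); rewrite ?orbT.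
Qed.

Lemma compat_no_star k a b c d : uniq [:: 3 * k; a; b; c; d] ->
  compat k a b -> compat k a c -> compat k a d -> False.
Proof.
rewrite cons_uniq => /andP[+ us]; rewrite !inE !negb_or ![3 * k == _]eq_sym.
case/and4P=> ax bx cx dx; rewrite !compat_div // => /eqP ab /eqP ac /eqP ad.
exact: uniq_div3 us ab ac ad.
Qed.

(** An edge with one compatible pair has all its pairs compatible, as does any edge through [3 * k].
    If [3 * k] is one of [a], [b], [c], [d], compatibility spreads along the copy until one vertex
    is compatible with the three others besides [3 * k], giving four vertices in a group of size
    three. *)
Lemma triple_edge_no_triangle k a b c d e : uniq [:: a; b; c; d; e] ->
  triple_edge k a b c -> triple_edge k a b d -> triple_edge k c d e ->
  3 * k \notin [:: a; b; c; d; e].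
Proof.
have xl z : compat k (3 * k) z by rewrite /compat eqxx.
have xr z : compat k z (3 * k) by rewrite compatC.
move=> us abc abd cde.
have nostar p q r s t : all [in [:: p; q; r; s; t]] [:: a; b; c; d; e] ->
    3 * k = p -> compat k q r -> compat k q s -> compat k q t -> False.
  by move=> /allP sub xp; apply: compat_no_star; rewrite xp (leq_size_uniq us sub).
have Fabc := triple_edge_flat abc; have Fabd := triple_edge_flat abd.
have Fcde := triple_edge_flat cde.
have [ab cd] : a != b /\ c != d.
  by move: us; rewrite /= !inE !negb_or => /and5P[/andP[-> _] _ /andP[-> _]].
rewrite !inE; apply/negP => /or4P[|||/orP[]] /eqP x.
- have [|_ _ bc] := Fabc; first by rewrite -x xl.
  have [|_ _ bd] := Fabd; first by rewrite -x xl.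
  rewrite compatC in bc.
  have cd' : compat k c d by apply: compat_trans bc bd; rewrite x eq_sym.
  have [|_ ce _] := Fcde; first by rewrite cd'.
  by apply: (nostar a c b d e) ; rewrite //= !inE !eqxx ?orbT.
- have [|_ ac' _] := Fabc; first by rewrite -x xr.
  have [|_ ad' _] := Fabd; first by rewrite -x xr.
  rewrite compatC in ac'.
  have cd' : compat k c d by apply: compat_trans ac' ad'; rewrite x.
  have [|_ ce _] := Fcde; first by rewrite cd'.
  by apply: (nostar b c a d e) ; rewrite //= !inE !eqxx ?orbT.
- have [|ab' _ _] := Fabc; first by rewrite -x xr ?orbT.
  have [|_ ad' bd] := Fabd; first by rewrite ab'.
  have [|_ _ de] := Fcde; first by rewrite -x xl.
  rewrite compatC in ad'; rewrite compatC in bd.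
  by apply: (nostar c d a b e) ; rewrite //= !inE !eqxx ?orbT.
- have [|ab' _ _] := Fabd; first by rewrite -x xr ?orbT.
  have [|_ ac' bc] := Fabc; first by rewrite ab'.
  have [|_ ce _] := Fcde; first by rewrite -x xr ?orbT.
  rewrite compatC in ac'; rewrite compatC in bc.
  by apply: (nostar d c a b e) ; rewrite //= !inE !eqxx ?orbT.
(* Here [c] and [d] share a group. If [a] and [b] are compatible, the previous argument applies.
   Otherwise [a b c] and [a b d] are transversal, so [c] and [d] also have equal labels and
   coincide. *)
- have [|cd' _ _] := Fcde; first by rewrite -x xr ?orbT.
  have nab : ~~ compat k a b.
    apply/negP=> ab'; have [|_ ac' bc] := Fabc; first by rewrite ab'.
    rewrite compatC in ac'; rewrite compatC in bc.
    by apply: (nostar e c a b d) ; rewrite //= !inE !eqxx ?orbT.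
  move: abc abd; rewrite /triple_edge (negPf nab) /= => /and3P[nac _ sc] /and3P[nad _ sd].
  move: cd'; rewrite compat_div.
  + by move=> /eqP; move: sc sd cd; clear; lia.
  + by apply: contraNneq nac => ->.
  + by apply: contraNneq nad => ->.
Qed.

Lemma triple_edges_uncovered k :
  ~ triangle_covered (Graph3 (triple_edges_card k)) ord_max.
Proof.
case=> a [b [c [d [e [/and4P[us]]]]]]; rewrite !mem_triple_edges.
move=> /andP[_ abc] /andP[_ abd] /andP[_ cde].
rewrite -(mem_map val_inj) /=; apply/negP.
apply: triple_edge_no_triangle abc abd cde.
by rewrite -(map_inj_uniq val_inj) in us.
Qed.

Lemma triple_threshold k : 3 < k ->
  1 < covering_threshold 2 (3 * k).+1 generalized_triangle.
Proof.
move=> k3; apply: leq_trans (threshold_ge (@triple_edges_uncovered k)).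
apply: min_degree2_ge => [|a b ab]; first by rewrite card_ord; lia.
have [p [q [[pk qk pq] [[ap bp aq bq] [abp abq]]]]] :=
  triple_edge_codegree k3 (ltn_ord a) (ltn_ord b) ab.
apply: (codegree_gt1 (c := inord p) (d := inord q)).
- by rewrite -val_eqE /= !inordK.
- by rewrite mem_triple_edges /= !inE -!val_eqE /= inordK // !negb_or ap bp abp ab.
- by rewrite mem_triple_edges /= !inE -!val_eqE /= inordK // !negb_or aq bq abq ab.
Qed.

(** * The values of the threshold *)

Lemma min_degree_uncovered n (G : graph3 'I_n) x : 5 <= n ->
  ~ triangle_covered G x -> 1 < min_degree 2 G ->
  [/\ min_degree 2 G = 2, n = 1 %[mod 3] & 12 < n].
Proof.
move=> n5 Gx G2; have cod a b (ab : a != b) : 1 < codegree G a b.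
  exact: leq_trans G2 (min_degree2_le G ab).
have [|a [b [ab c2]]] := uncovered_codegree2 Gx cod; first by rewrite card_ord; lia.
have nE := card_uncovered Gx cod; rewrite card_ord in nE.
have := uncovered_parts Gx cod; rewrite card_ord => /(_ n5).
have := min_degree2_le G ab; rewrite c2; split; lia.
Qed.

Theorem theorem1 (n : nat) (n_ge5 : 5 <= n) :
  [/\ n <= 10 -> covering_threshold 2 n generalized_triangle = 1,
      11 <= n -> n - 1 = 0 %[mod 3] ->
        covering_threshold 2 n generalized_triangle = 2
    & 11 <= n -> n - 1 = 1 %[mod 3] \/ n - 1 = 2 %[mod 3] ->
        covering_threshold 2 n generalized_triangle = 1].
Proof.
have star : 0 < covering_threshold 2 n generalized_triangle.
  by apply: star_threshold; lia.
have le1 : ~ (n = 1 %[mod 3] /\ 12 < n) ->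
    covering_threshold 2 n generalized_triangle = 1.
  move=> n_bad; apply/eqP; rewrite eqn_leq star andbT; apply: threshold_le => G x Gx.
  by rewrite leqNgt; apply/negP => /(min_degree_uncovered n_ge5 Gx)[_ n1 n12]; case: n_bad.
split=> [n10|n11 n1|n11 n1]; [by apply: le1; lia| |by apply: le1; lia].
apply/eqP; rewrite eqn_leq; apply/andP; split.
  apply: threshold_le => G x Gx; rewrite leqNgt; apply/negP => G3.
  by have [G2 _ _] := min_degree_uncovered n_ge5 Gx (ltnW G3); rewrite G2 ltnn in G3.
(* As [n] is 1 mod 3, [11 <= n] already forces 13 vertices, hence at least four groups. *)
have -> : n = (3 * (n %/ 3)).+1 by lia.
by apply: triple_threshold; lia.
Qed.
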